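(* Let $0\le a<b\le n$, $d\ge1$, and let $\Gamma=\Gamma^{2,d}_{a,b,\{1\}}$ or $\Gamma=\Gamma^{2,d}_{a,b,\{2\}}$. Then $M_\Gamma$ is a point and the equivariant Euler class is given by $$e^{K\times T}(i_\Gamma^*\overline{N}_{2,d})=\prod_{0\le q\le2d-1}\Big(\kappa+\tfrac{2d-2q-1}{2d}\tau_a-\tfrac{2d-2q-1}{2d}\tau_b\Big)\cdot\prod_{\substack{0\le m\le n\\ m\ne a,b}}\ \prod_{0\le q\le d-1}\Big(\kappa+\tfrac{2q-1}{2d}\tau_a-\tfrac{2d-2q-1}{2d}\tau_b+\tau_m\Big).$$
   Context: $T=(\mathbb{C}^* )^{n+1}$ acts on $\mathbb{P}^n$ by $a_t[X^0:\dots:X^n]=[X^0/t_0:\dots:X^n/t_n]$, with fixed points $q_0,\dots,q_n$ ($q_i$: all homogeneous coordinates except the $i$-th vanish). $H_T^\bullet(\mathrm{pt})=\mathbb{C}[\tau_0,\dots,\tau_n]$ with the convention that the one-dimensional representation $t\cdot v=t_0^{d_0}\cdots t_n^{d_n}v$ has weight $-d_0\tau_0-\dots-d_n\tau_n$; the same convention is used for fractional exponents. $T$ acts on the stack $\overline{M}_{0,k}(\mathbb{P}^n,d)$ of genus zero, $k$-pointed, degree $d$ stable maps, and on the stack $\overline{M}^{spin}_{0,k}(\mathbb{P}^n,d)$ of such maps together with a spinor bundle on the domain, by $\phi\mapsto a_t\circ\phi$. For $A\subset\{1,2\}$, the graph $\Gamma^{2,d}_{a,b,A}$ has two vertices labelled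 $a$ and $b$ joined by one edge labelled $d$, with the marked points in $A$ attached to vertex $a$ and those in $\{1,2\}\setminus A$ attached to vertex $b$. It represents the component $M_\Gamma\subset\overline{M}_{0,2}(\mathbb{P}^n,d)$ of the $T$-fixed locus consisting of stable maps with exactly one non-contracted component, mapped with degree $d$ onto the line through $q_a,q_b$, with marked points with label in $A$ mapped to $q_a$ and the others to $q_b$. Its preimage in the spin stack is $i_\Gamma\colon M^{spin}_\Gamma\to\overline{M}^{spin}_{0,2}(\mathbb{P}^n,d)$. For $\#A=1$ such a map is $\phi\colon C=\mathbb{P}^1\to\mathbb{P}^n$, $[Z^1:Z^2]\mapsto[0:\dots:(Z^1)^d:\dots:(Z^2)^d:\dots:0]$ (nonzero entries in positions $a$ and $b$), the two marked points $p_1,p_2$ being $[0:1]$ and $[1:0]$, labelled accordingly. $\overline{N}_{2,d}$ is the SUSY normal bundle on $\overline{M}^{spin}_{0,2}(\mathbb{P}^n,d)$, whose restriction $i_\Gamma^*\overline{N}_{2,d}$ is the vector space $N_{(C,\phi)}$ defined by $$0\to H^0(S_C)\to p_1^*S_C\oplus p_2^*S_C\oplus H^0(S_C^\vee\otimes\phi^*T\mathbb{P}^n)\to N_{(C,\phi)}\to0,\qquad s\mapsto(p_1^*s,\,p_2^*s,\,-\langle s,d\phi\rangle),$$ where $S_C=\mathcal{O}(1)$ is the spinor bundle, $S_C\otimes S_C=TC$, and $\langle s,d\phi\rangle$ is the contraction of $s$ with $d\phi\in H^0(S_C^\vee\otimes S_C^\vee\otimes\phi^*T\mathbb{P}^n)$.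 The $T$-action on it is induced by $\mathrm{id}_{S_C^\vee}\otimes\phi^*da_t\colon H^0(S_C^\vee\otimes\phi^*T\mathbb{P}^n)\to H^0(S_C^\vee\otimes(a_t\circ\phi)^*T\mathbb{P}^n)$ and is trivial on $S_C$, where the SUSY normal bundles of $(C,p_1,p_2,a_t\circ\phi)$ and $(C,p_1,p_2,\phi)$ are identified by the spin isomorphism of $(\mathbb{P}^1,\mathcal{O}(1))$ given by $\mathrm{diag}\big((t_b/t_a)^{1/2d},(t_a/t_b)^{1/2d}\big)\in SL(2)$, whose Möbius transformation $\xi_t$ satisfies $a_t\circ\phi=\phi\circ\xi_t$. $K=\mathbb{C}^*$ acts by scaling with weight $\kappa$. $e^{K\times T}$ denotes the $K\times T$-equivariant Euler class.
   Formalization: In the second product the coefficient of τ_a is corrected from (2q−1)/2d to −(2q+1)/2d (the printed formula fails for d, n ≥ 2, since each weight's τ-coefficients must sum to 0); ''M_Γ is a point'' is stated for isomorphism classes of stable maps. *)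

(* Defs.v *)
From HB Require Import structures.
From mathcomp Require Import all_boot all_order all_algebra.
From mathcomp Require Import complex mpoly.
From mathcomp Require Import functions reals ring.

Set Implicit Arguments.
Unset Strict Implicit.
Unset Printing Implicit Defensive.

Import GRing.Theory Num.Theory.
Local Open Scope ring_scope.

(* A point of P^m is represented by a nonzero row vector up to [proj_eq].     *)
Definition proj_eq (C : fieldType) (m : nat) (u v : 'rV[C]_m) : Prop :=
  exists2 c : C, c != 0 & v = c *: u.

(* The torus (C^* )^{n+1}, as a condition on (n+1)-tuples of scalars.         *)
Definition in_torus (C : fieldType) (n : nat) (t : 'I_n.+1 -> C) : Prop :=
  forall j, t j != 0.

Definition torus_act (C : fieldType) (n : nat) (t : 'I_n.+1 -> C)
  (x : 'rV[C]_n.+1) : 'rV[C]_n.+1 := \row_j (x 0 j / t j).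

Definition qpt (C : fieldType) (n : nat) (i : 'I_n.+1) : 'rV[C]_n.+1 :=
  delta_mx 0 i.

(* Lifts to C^2 \ 0 -> C^{n+1} \ 0 of maps P^1 -> P^n are given by n+1 binary *)
(* forms of the same degree without common zero.                              *)
Definition ev_forms (C : fieldType) (n : nat) (F : 'I_n.+1 -> {mpoly C[2]})
  (Z : 'rV[C]_2) : 'rV[C]_n.+1 := \row_j (F j).@[Z 0].

Definition is_lift (C : fieldType) (n d : nat) (F : 'I_n.+1 -> {mpoly C[2]}) :
  Prop :=
  (forall j, F j \is d.-homog) /\ (forall Z, Z != 0 -> ev_forms F Z != 0).

Definition torus_act_forms (C : fieldType) (n : nat) (t : 'I_n.+1 -> C)
  (F : 'I_n.+1 -> {mpoly C[2]}) : 'I_n.+1 -> {mpoly C[2]} :=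
  fun j => (t j)^-1 *: F j.

(* Data of a k-pointed genus zero nodal curve with a map to P^n: the          *)
(* components are copies of P^1, [sm_adj v w] says that the components v and  *)
(* w meet, and then [sm_node v w] is the point of v at which they meet.       *)
Record map_data (C : fieldType) (n k : nat) := MapData {
  sm_comp : finType;
  sm_adj : rel sm_comp;
  sm_node : sm_comp -> sm_comp -> 'rV[C]_2;
  sm_deg : sm_comp -> nat;
  sm_map : sm_comp -> 'I_n.+1 -> {mpoly C[2]};
  sm_mark : 'I_k -> sm_comp;
  sm_mpt : 'I_k -> 'rV[C]_2 }.

(* The dual graph is a tree: connected, with one edge less than vertices      *)
(* (each edge is counted twice in [sm_adj]).                                  *)
Definition is_tree (V : finType) (e : rel V) : Prop :=
  [/\ ssrbool.symmetric e, irreflexive e, (0 < #|V|)%N,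
      (forall v w, connect e v w) &
      #|[set p : V * V | e p.1 p.2]| = (#|V|.-1).*2 ].

Definition special_points_distinct (C : fieldType) (n k : nat)
  (X : map_data C n k) : Prop :=
  [/\ (forall v w, sm_adj v w -> sm_node (m := X) v w != 0) /\
      (forall i, sm_mpt X i != 0),
      (forall v w w', sm_adj v w -> sm_adj v w' -> w <> w' ->
         ~ proj_eq (sm_node (m := X) v w) (sm_node v w')),
      (forall i w, sm_adj (sm_mark X i) w ->
         ~ proj_eq (sm_node (sm_mark X i) w) (sm_mpt X i)) &
      (forall i j, i <> j -> sm_mark X i = sm_mark X j ->
         ~ proj_eq (sm_mpt X i) (sm_mpt X j)) ].

Definition is_stable_map (C : fieldType) (n k d : nat) (X : map_data C n k) :
  Prop :=
  [/\ is_tree (sm_adj (m := X)) /\ special_points_distinct X,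
      (forall v : sm_comp X, is_lift (sm_deg v) (sm_map v)),
      (forall v w : sm_comp X, sm_adj v w ->
         proj_eq (ev_forms (sm_map v) (sm_node v w))
                 (ev_forms (sm_map w) (sm_node w v))),
      (forall v : sm_comp X, sm_deg v = 0%N ->
         (3 <= #|[set w | sm_adj v w]| + #|[set i | sm_mark X i == v]|)%N) &
      (\sum_(v : sm_comp X) sm_deg v = d)%N ].

(* [f] is the bijection on components; the isomorphism between the components *)
(* v and f v is the Moebius transformation Z |-> Z *m g v.                    *)
Definition stable_map_iso (C : fieldType) (n k : nat) (X Y : map_data C n k) :
  Prop :=
  exists (f : sm_comp X -> sm_comp Y) (g : sm_comp X -> 'M[C]_2),
  [/\ bijective f /\ (forall v, g v \in unitmx),
      (forall v w, sm_adj (f v) (f w) = sm_adj v w),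
      (forall v w, sm_adj v w ->
         proj_eq (sm_node (f v) (f w)) (sm_node v w *m g v)),
      (forall i, sm_mark Y i = f (sm_mark X i) /\
         proj_eq (sm_mpt Y i) (sm_mpt X i *m g (sm_mark X i))) &
      (forall v Z, Z != 0 ->
         proj_eq (ev_forms (sm_map (f v)) (Z *m g v))
                 (ev_forms (sm_map v) Z)) ].

Definition torus_act_map (C : fieldType) (n k : nat) (t : 'I_n.+1 -> C)
  (X : map_data C n k) : map_data C n k :=
  MapData (sm_adj (m := X)) (sm_node (m := X)) (sm_deg (m := X))
    (fun v => torus_act_forms t (sm_map v)) (sm_mark X) (sm_mpt X).

Definition torus_fixed (C : fieldType) (n k : nat) (X : map_data C n k) : Prop :=
  forall t, in_torus t -> stable_map_iso (torus_act_map t X) X.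

Definition on_line (C : fieldType) (n : nat) (a b : 'I_n.+1)
  (x : 'rV[C]_n.+1) : Prop := forall j, j != a -> j != b -> x 0 j = 0.

(* The points of M_Gamma for the one-edge graph Gamma with vertices a, b,     *)
(* edge label d, and the marked points of A attached to a.  The marked points *)
(* 1, 2 are the elements 0, 1 of 'I_2.                                        *)
Definition in_M_Gamma (C : fieldType) (n d : nat) (a b : 'I_n.+1)
  (A : {set 'I_2}) (X : map_data C n 2) : Prop :=
  [/\ is_stable_map d X, torus_fixed X,
      (exists v0 : sm_comp X,
         [/\ sm_deg v0 = d, (forall v, v != v0 -> sm_deg v = 0%N),
             (forall Z, on_line a b (ev_forms (sm_map v0) Z)) &
             (forall x, x != 0 -> on_line a b x ->
                exists2 Z, Z != 0 & proj_eq (ev_forms (sm_map v0) Z) x) ]) &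
      (forall i, proj_eq (ev_forms (sm_map (sm_mark X i)) (sm_mpt X i))
                         (qpt C (if i \in A then a else b))) ].

Definition edge_forms (C : fieldType) (n d : nat) (a b : 'I_n.+1) :
  'I_n.+1 -> {mpoly C[2]} :=
  fun j => if j == a then 'X_0 ^+ d else if j == b then 'X_1 ^+ d else 0.

(* [1:0] is mapped to q_a and [0:1] to q_b.                                   *)
Definition edge_mpt (C : fieldType) (A : {set 'I_2}) (i : 'I_2) : 'rV[C]_2 :=
  delta_mx 0 (if i \in A then 0 else 1).

Definition edge_map (C : fieldType) (n d : nat) (a b : 'I_n.+1)
  (A : {set 'I_2}) : map_data C n 2 :=
  @MapData C n 2 unit (fun _ _ => false) (fun _ _ => 0) (fun _ => d)
    (fun _ => @edge_forms C n d a b) (fun _ => tt) (@edge_mpt C A).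

(* A global section of S^v (x) phi^*TP^n, where S = O(1) and the map phi has  *)
(* the lift F of degree d, is represented by a function                       *)
(* sigma : C^2 \ 0 -> C^{n+1}.  The fibre of S^v = O(-1) at [Z] is the line   *)
(* through Z, the tangent space of P^n at phi[Z] is C^{n+1}/<F(Z)>, and the   *)
(* value of the section at [Z] is Z (x) sigma(Z); thus sigma matters only     *)
(* modulo F, and is homogeneous of degree d - 1 modulo F.  By the Euler       *)
(* sequence, sections over the two affine charts are the images of            *)
(* (n+1)-tuples of polynomials in the affine coordinate.                      *)
Definition is_section (C : fieldType) (n d : nat) (F : 'I_n.+1 -> {mpoly C[2]})
  (sigma : 'rV[C]_2 -> 'rV[C]_n.+1) : Prop :=
  (exists u : 'I_n.+1 -> {poly C}, forall Z : 'rV[C]_2, Z 0 0 != 0 ->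
     exists c : C, sigma Z =
       (Z 0 0 ^+ d / Z 0 0) *: (\row_j (u j).[Z 0 1 / Z 0 0])
       + c *: ev_forms F Z) /\
  (exists u : 'I_n.+1 -> {poly C}, forall Z : 'rV[C]_2, Z 0 1 != 0 ->
     exists c : C, sigma Z =
       (Z 0 1 ^+ d / Z 0 1) *: (\row_j (u j).[Z 0 0 / Z 0 1])
       + c *: ev_forms F Z).

(* sections of S = O(1) are linear forms *)
Definition ev_lin (C : fieldType) (s : 'cV[C]_2) (Z : 'rV[C]_2) : C :=
  (Z *m s) 0 0.

Definition deriv_forms (C : fieldType) (n : nat) (F : 'I_n.+1 -> {mpoly C[2]})
  (Z w : 'rV[C]_2) : 'rV[C]_n.+1 :=
  \row_j \sum_(i < 2) w 0 i * ((F j)^`M(i)).@[Z 0].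

(* tau represents <s, dphi>.  Since T_[Z]P^1 = Hom(<Z>, C^2/<Z>), the         *)
(* identification of S (x) S with TP^1 given by det : <Z> (x) C^2/<Z> -> C    *)
(* makes the contraction at Z equal to s(Z) times the derivative of F along   *)
(* any w with det(Z, w) = 1; another choice of w changes it by a multiple of  *)
(* F(Z).                                                                      *)
Definition is_contraction (C : fieldType) (n : nat)
  (F : 'I_n.+1 -> {mpoly C[2]}) (s : 'cV[C]_2)
  (tau : 'rV[C]_2 -> 'rV[C]_n.+1) : Prop :=
  forall Z w : 'rV[C]_2, Z 0 0 * w 0 1 - Z 0 1 * w 0 0 = 1 ->
  exists c : C, tau Z = ev_lin s Z *: deriv_forms F Z w + c *: ev_forms F Z.

(* The vector space N_(C,phi) is presented as N_num / N_den inside            *)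
(* [susy_ambient].  An element of p_i^*S is a linear form modulo those        *)
(* vanishing at p_i, an element of H^0(S^v (x) phi^*TP^n) is a representative *)
(* as above modulo multiples of F, and N_den is the preimage of               *)
(* { (p_1^*s, p_2^*s, - <s, dphi>) | s in H^0(S) }.                           *)
Definition susy_ambient (C : fieldType) (n : nat) : lmodType C :=
  ('cV[C]_2 * 'cV[C]_2 * ('rV[C]_2 -> 'rV[C]_n.+1))%type.

Definition N_num (C : fieldType) (n d : nat) (F : 'I_n.+1 -> {mpoly C[2]})
  (x : susy_ambient C n) : Prop := is_section d F x.2.

Definition N_den (C : fieldType) (n : nat) (F : 'I_n.+1 -> {mpoly C[2]})
  (p : 'I_2 -> 'rV[C]_2) (x : susy_ambient C n) : Prop :=
  exists s : 'cV[C]_2,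
  [/\ ev_lin x.1.1 (p 0) = ev_lin s (p 0),
      ev_lin x.1.2 (p 1) = ev_lin s (p 1) &
      is_contraction F s (- x.2) ].

(* The operation on [susy_ambient] of k in K, combined with t in T and an     *)
(* element g of SL(2) such that F(Z g) = lam t.F(Z), where t.F is the lift    *)
(* [torus_act_forms t F] of a_t o phi.  First da_t maps sigma to              *)
(* [torus_act t \o sigma], relative to the lift t.F; then one applies the     *)
(* inverse of the pullback by g, which on S is s |-> s(_ g) and on sections   *)
(* is sigma |-> lam^-1 sigma(_ g), the factor lam^-1 accounting for the       *)
(* change of lift from F(_ g) to t.F.                                         *)
Definition susy_act (C : fieldType) (n : nat) (k : C) (t : 'I_n.+1 -> C)
  (g : 'M[C]_2) (lam : C) (x : susy_ambient C n) : susy_ambient C n :=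
  k *: ((invmx g *m x.1.1, invmx g *m x.1.2,
         fun Z => lam *: torus_act t (x.2 (Z *m invmx g))) : susy_ambient C n).

(* The fractional powers of t are handled on the covering torus with          *)
(* coordinates r_j, t_j = r_j^{2d}; then (t_b/t_a)^{1/2d} = r_b/r_a.          *)
Definition cover_pow (C : fieldType) (n d : nat) (r : 'I_n.+1 -> C) :
  'I_n.+1 -> C := fun j => r j ^+ (2 * d).

Definition spin_diag (C : fieldType) (n : nat) (a b : 'I_n.+1)
  (r : 'I_n.+1 -> C) : 'M[C]_2 :=
  diag_mx (\row_i (if i == 0 then r b / r a else r a / r b)).

Lemma spin_diagE (C : fieldType) (n d : nat) (a b : 'I_n.+1)
  (r : 'I_n.+1 -> C) (Z : 'rV[C]_2) :
  a != b -> in_torus r ->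
  ev_forms (edge_forms C d a b) (Z *m spin_diag a b r) =
  (r a * r b) ^+ d *:
    ev_forms (torus_act_forms (cover_pow d r) (edge_forms C d a b)) Z.
Proof.
move=> neq_ab hr; apply/rowP => j.
have ZE i : (Z *m spin_diag a b r) 0 i
    = Z 0 i * (if i == 0 then r b / r a else r a / r b).
  by rewrite mul_mx_diag !mxE.
rewrite !mxE /torus_act_forms /edge_forms mevalZ /cover_pow.
have [->|_] := eqVneq j a.
  rewrite !rmorphXn /= !mevalXU ZE /= exprM -exprVn -!exprMn.
  by congr (_ ^+ _); field; rewrite (hr a).
have [->|_] := eqVneq j b.
  rewrite !rmorphXn /= !mevalXU ZE /= exprM -exprVn -!exprMn.
  by congr (_ ^+ _); field; rewrite (hr b).
by rewrite !meval0 ?mulr0.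
Qed.

Definition edge_act (C : fieldType) (n d : nat) (a b : 'I_n.+1)
  (k : C) (r : 'I_n.+1 -> C) : susy_ambient C n -> susy_ambient C n :=
  susy_act k (cover_pow d r) (spin_diag a b r) ((r a * r b) ^+ d).

(* H^*_{K x T}(pt) = C[tau_0, .., tau_n][kappa] *)
Definition kappa (C : fieldType) (n : nat) : {poly {mpoly C[n.+1]}} := 'X.

Definition tau (C : fieldType) (n : nat) (q : C) (j : 'I_n.+1) :
  {poly {mpoly C[n.+1]}} := (q *: 'X_j)%:P.

(* The weight of the character k^c * prod_j r_j^{e_j} of the product of K     *)
(* with the N-fold covering r_j^N = t_j of T, i.e. k^c * prod_j t_j^{e_j/N}:  *)
(* scaling by K has weight + kappa, while t_j has weight - tau_j.             *)
Definition weight (C : fieldType) (n N : nat) (c : int) (e : 'I_n.+1 -> int) :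
  {poly {mpoly C[n.+1]}} :=
  kappa C n *~ c - \sum_j tau ((e j)%:~R / N%:R) j.

(* e is the equivariant Euler class of the finite dimensional representation  *)
(* V / W: the product of the weights, with multiplicities, in a decomposition *)
(* into one-dimensional representations.                                      *)
Definition is_euler_class (C : fieldType) (n N : nat) (L : lmodType C)
  (V W : L -> Prop) (rho : C -> ('I_n.+1 -> C) -> L -> L)
  (e : {poly {mpoly C[n.+1]}}) : Prop :=
  exists (m : nat) (v : 'I_m -> L) (c : 'I_m -> int)
         (E : 'I_m -> 'I_n.+1 -> int),
  [/\ (forall i, V (v i)),
      (forall x, V x -> exists! y : 'rV[C]_m, W (x - \sum_i y 0 i *: v i)),
      (forall i k r, k != 0 -> in_torus r ->
         W (rho k r (v i) - (k ^ c i * \prod_j r j ^ E i j) *: v i)) &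
      e = \prod_i weight C N (c i) (E i) ].

Definition is_edge_euler_class (C : fieldType) (n d : nat) (a b : 'I_n.+1)
  (A : {set 'I_2}) (e : {poly {mpoly C[n.+1]}}) : Prop :=
  is_euler_class (2 * d) (N_num d (edge_forms C d a b))
    (N_den (edge_forms C d a b) (edge_mpt C A))
    (@edge_act C n d a b) e.

(* Main.v *)
Require Import Defs.
From HB Require Import structures.
From mathcomp Require Import all_boot all_order all_algebra.
From mathcomp Require Import complex mpoly.
From mathcomp Require Import functions reals ring zify.

Set Implicit Arguments.
Unset Strict Implicit.
Unset Printing Implicit Defensive.

Import GRing.Theory Num.Theory.
Local Open Scope ring_scope.

(** The fixed component is a point.  A stable map in it has one component of
    positive degree, and its two markings have distinct images, so that no
    contracted component carries both.  Stability then makes each contracted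
    component meet at least two others, and too many edges result for a tree ([marked_tree_single]): the domain is a single P^1.  There the
    map is given by two coprime binary forms F_a, F_b, of which F_b vanishes at
    the marking over q_a and F_a at the one over q_b.  Invariance under a
    torus element with t_a / t_b of infinite order forces each form to be a
    monomial in the coordinates that put the markings at 0 and infinity
    ([rigid_fraction], [rigid_line_map]); since F_a, F_b have no common zero,
    the map is z |-> z^d up to rescaling.

    The Euler class.  Evaluation H^0(S) -> p_1^*S + p_2^*S is an isomorphism,
    as linear forms on C^2 are determined by their values at two points; so N
    is isomorphic to H^0(S^v (x) phi^*TP^n).  Twisting the Euler sequence by
    S^v = O(-1) gives
      0 -> O(-1) -> O(d-1)^{n+1} -> S^v (x) phi^*TP^n -> 0,
    and O(-1) has neither H^0 nor H^1, so that every section is represented by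
    exactly one (n+1)-tuple of binary forms of degree d-1
    ([section_by_forms], [forms_section_inj]).  Hence the (n+1)d vectors
    Z_0^q Z_1^{d-1-q} e_m, with 0 <= q < d and 0 <= m <= n, are a basis of N
    ([section_vec_basis]), and they are eigenvectors of the torus
    ([edge_act_section_vec]).  Those with m = a and m = b contribute, together,
    the 2d weights tangent to the line; the others are the weights normal to
    it ([prod_edge_weight]). *)

(** * Polynomials on the two charts of the projective line *)

Lemma poly_eq_punctured (C : numFieldType) (p q : {poly C}) :
  (forall z, z != 0 -> p.[z] = q.[z]) -> p = q.
Proof.
move=> eq_pq; apply/eqP; rewrite -subr_eq0; apply/negPn/negP => nz_pq.
pose rs := [seq (i.+1)%:R : C | i <- iota 0 (size (p - q))].
have rs_root : all (root (p - q)) rs.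
  apply/allP => _ /mapP[i _ ->].
  by rewrite /root hornerD hornerN eq_pq ?subrr // pnatr_eq0.
have rs_uniq : uniq rs.
  rewrite map_inj_uniq ?iota_uniq // => i j /eqP.
  by rewrite eqr_nat eqSS => /eqP.
have := max_poly_roots nz_pq rs_root rs_uniq.
by rewrite size_map size_iota ltnn.
Qed.

(** The sections of O(N) over P^1: a pair of functions p, q, one on each affine
    chart, that agree on the overlap up to z^N comes from a binary form of
    degree N, and the value of q at its origin is the top coefficient of p. *)
Lemma pole_bound (C : numFieldType) (N : nat) (p q : {poly C}) :
  (forall z, z != 0 -> p.[z] = z ^+ N * q.[z^-1]) ->
  (size p <= N.+1)%N /\ q.[0] = p`_N.
Proof.
move=> pq; set k := size q.
(* Multiplying by X^k clears the negative powers in z^N q(1/z). *)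
pose rq : {poly C} := \sum_(j < k) q`_j *: 'X^(N + k - j).
have coef_rq m : rq`_m = \sum_(j < k) q`_j * (m == N + k - j)%N%:R.
  by rewrite coef_sum; apply: eq_bigr => j _; rewrite coefZ coefXn.
have eq_rq : p * 'X^k = rq.
  apply: poly_eq_punctured => z z0.
  rewrite hornerM hornerXn pq // /rq horner_sum horner_coef mulr_sumr mulr_suml.
  apply: eq_bigr => j _; rewrite hornerZ hornerXn.
  have le_jk : (j <= k)%N by rewrite ltnW.
  rewrite -addnBA // exprD -{1}(subnK le_jk) exprD exprVn.
  by field; rewrite expf_neq0.
have coef_p m : p`_m = rq`_(m + k).
  by rewrite -eq_rq coefMXn ltnNge leq_addl addnK.
split.
  apply/leq_sizeP => m lt_Nm; rewrite coef_p coef_rq big1 // => j _.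
  by rewrite gtn_eqF ?mulr0 // (leq_ltn_trans (leq_subr _ _)) // ltn_add2r.
rewrite coef_p coef_rq horner_coef0.
have eq_j (j : 'I_k) : (N + k == N + k - j)%N = (j == 0 :> nat)%N.
  by have := ltn_ord j; lia.
under eq_bigr => j _ do rewrite eq_j.
have [k0|k_gt0] := posnP k.
  rewrite big1 => [|j _]; last by have := ltn_ord j; rewrite {2}k0.
  by rewrite nth_default // leqn0 -/k k0.
rewrite (bigD1 (Ordinal k_gt0)) //= mulr1 big1 ?addr0 // => j.
by rewrite -val_eqE /= => /negPf->; rewrite mulr0.
Qed.

Definition homogenize (C : fieldType) (N : nat) (p : {poly C}) (x y : C) : C :=
  \sum_(i < N.+1) p`_i * x ^+ (N - i) * y ^+ i.

Lemma homogenize_chart (C : fieldType) N (p : {poly C}) (x y : C) :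
  x != 0 -> (size p <= N.+1)%N ->
  homogenize N p x y = x ^+ N * p.[y / x].
Proof.
move=> x0 sp; rewrite (horner_coef_wide _ sp) mulr_sumr; apply: eq_bigr => i _.
have le_iN : (i <= N)%N by rewrite -ltnS.
have -> : x ^+ N = x ^+ (N - i) * x ^+ i by rewrite -exprD subnK.
by rewrite expr_div_n; field; rewrite expf_neq0.
Qed.

Lemma homogenize0l (C : fieldType) N (p : {poly C}) (y : C) :
  homogenize N p 0 y = p`_N * y ^+ N.
Proof.
rewrite /homogenize big_ord_recr /= subnn expr0 mulr1 big1 ?add0r // => i _.
by rewrite expr0n subn_eq0 leqNgt ltn_ord mulr0 mul0r.
Qed.

Lemma homogenize0r (C : fieldType) N (p : {poly C}) (x : C) :
  homogenize N p x 0 = p`_0 * x ^+ N.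
Proof.
rewrite /homogenize big_ord_recl /= subn0 mulr1 big1 ?addr0 // => i _.
by rewrite expr0n mulr0.
Qed.

Lemma homogenizeD (C : fieldType) N (p q : {poly C}) x y :
  homogenize N (p + q) x y = homogenize N p x y + homogenize N q x y.
Proof.
by rewrite /homogenize -big_split; apply: eq_bigr => i _; rewrite coefD !mulrDl.
Qed.

Lemma homogenizeB (C : fieldType) N (p q : {poly C}) x y :
  homogenize N (p - q) x y = homogenize N p x y - homogenize N q x y.
Proof.
by rewrite /homogenize -sumrB; apply: eq_bigr => i _; rewrite coefB !mulrBl.
Qed.

Lemma meval_homog (C : fieldType) d (f : {mpoly C[2]}) (c : C) (Z : 'rV[C]_2) :
  f \is d.-homog -> f.@[(c *: Z) 0] = c ^+ d * f.@[Z 0].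
Proof.
move/dhomogP => homog_f; rewrite !mevalE mulr_sumr.
apply: eq_big_seq => m /homog_f.
rewrite /= mdegE => deg_m; rewrite mulrCA; congr (_ * _).
rewrite -deg_m -prodrXr -big_split /=.
by apply: eq_bigr => i _; rewrite mxE exprMn.
Qed.

Lemma meval_deg0 (C : fieldType) (f : {mpoly C[2]}) (Z Z' : 'rV[C]_2) :
  f \is 0.-homog -> f.@[Z 0] = f.@[Z' 0].
Proof.
move=> homog_f; rewrite -[LHS]mul1r -[RHS]mul1r -(expr0 0).
by rewrite -!(meval_homog _ _ homog_f) !scale0r.
Qed.

Lemma meval_line (C : fieldType) (f : {mpoly C[2]}) (v w : 'rV[C]_2) :
  exists p : {poly C}, forall z, p.[z] = f.@[(v + z *: w) 0].
Proof.
exists (mmap polyC (fun i => (v 0 i)%:P + (w 0 i) *: 'X) f) => z.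
rewrite /mmap horner_sum mevalE; apply: eq_bigr => m _.
rewrite hornerM hornerC /mmap1 horner_prod; congr (_ * _).
apply: eq_bigr => i _.
by rewrite horner_exp hornerD hornerC hornerZ hornerX !mxE [z * _]mulrC.
Qed.

(** A linear change of variables turns a form of degree d into another one; its
    restrictions to the two charts are glued by [pole_bound], which avoids
    expanding products of linear forms. *)
Lemma meval_pencil (C : numFieldType) d (f : {mpoly C[2]}) (v w : 'rV[C]_2) :
  f \is d.-homog ->
  exists2 p : {poly C}, (size p <= d.+1)%N &
    forall x y, f.@[(x *: v + y *: w) 0] = homogenize d p x y.
Proof.
move=> homog_f.
have [p pE] := meval_line f v w; have [q qE] := meval_line f w v.
have [size_p q0] : (size p <= d.+1)%N /\ q.[0] = p`_d.
  apply: pole_bound => z z0; rewrite pE qE.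
  rewrite -(meval_homog _ _ homog_f) scalerDr scalerA.
  by rewrite divff // scale1r addrC.
exists p => // x y; have [->|x0] := eqVneq x 0.
  rewrite homogenize0l -q0 qE !scale0r add0r addr0.
  by rewrite (meval_homog _ _ homog_f) mulrC.
rewrite homogenize_chart // pE -(meval_homog _ _ homog_f) scalerDr scalerA.
by rewrite mulrC divfK.
Qed.

(** * Linear algebra in two coordinates *)

Lemma ord2_neq0 (i : 'I_2) : i != 0 -> i = 1.
Proof. by case: i => -[|[|//]] // lt_i _; apply: val_inj. Qed.

Lemma rV2_neq0 (C : fieldType) (Z : 'rV[C]_2) :
  Z != 0 -> Z 0 0 != 0 \/ Z 0 1 != 0.
Proof.
move=> Z0; have [Z00|] := eqVneq (Z 0 0) 0; last by left.
right; apply: contraNneq Z0 => Z01; apply/eqP/rowP => i; rewrite mxE.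
by have [->//|/ord2_neq0->] := eqVneq i 0.
Qed.

Lemma delta_mx_neq0 (C : fieldType) (i : 'I_2) : (delta_mx 0 i : 'rV[C]_2) != 0.
Proof. by apply/eqP => /rowP/(_ i)/eqP; rewrite !mxE !eqxx oner_eq0. Qed.

Lemma proj_eq_refl (C : fieldType) m (x : 'rV[C]_m) : proj_eq x x.
Proof. by exists 1; rewrite ?oner_neq0 ?scale1r. Qed.

Lemma proj_eq_qpt (C : fieldType) n (x : 'rV[C]_n.+1) (i : 'I_n.+1) :
  proj_eq x (qpt C i) -> x 0 i != 0 /\ forall j, j != i -> x 0 j = 0.
Proof.
case=> c c0 eq_x; split.
  move/rowP/(_ i): eq_x; rewrite !mxE !eqxx /= => eq_x.
  by apply: contra_eqN eq_x => /eqP->; rewrite mulr0 oner_eq0.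
move=> j neq_ji; move/rowP/(_ j)/eqP: eq_x; rewrite !mxE (negPf neq_ji) andbF.
by rewrite eq_sym mulf_eq0 (negPf c0) => /eqP.
Qed.

Definition pair_mx (C : fieldType) (v w : 'rV[C]_2) : 'M[C]_2 :=
  \matrix_i (if i == 0 then v else w).

Lemma mul_pair_mx (C : fieldType) (v w u : 'rV[C]_2) :
  u *m pair_mx v w = u 0 0 *: v + u 0 1 *: w.
Proof.
rewrite mulmx_sum_row 2!big_ord_recl big_ord0 addr0 !rowK /=.
by congr (_ + u 0 _ *: _); apply: val_inj.
Qed.

Lemma pair_mx_unit (C : fieldType) (v w : 'rV[C]_2) :
  v != 0 -> w != 0 -> ~ proj_eq v w -> pair_mx v w \in unitmx.
Proof.
move=> v0 w0 indep; rewrite -row_free_unit; apply: inj_row_free => u.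
rewrite mul_pair_mx => /eqP; have [u1|u1] := eqVneq (u 0 1) 0.
  rewrite u1 scale0r addr0 scaler_eq0 (negPf v0) orbF => /eqP u0.
  apply/rowP => i; rewrite mxE.
  by case: i => -[|[|//]] lt_i; [rewrite -[RHS]u0|rewrite -[RHS]u1];
    congr (u 0 _); apply: val_inj.
rewrite addrC addr_eq0 -scaleNr => /eqP eq_uw; case: indep.
have eq_w : w = (- u 0 0 / u 0 1) *: v.
  by rewrite mulrC -scalerA -eq_uw scalerA mulVf // scale1r.
exists (- u 0 0 / u 0 1) => //.
by apply: contraNneq w0 => c0; rewrite eq_w c0 scale0r.
Qed.

Definition diag2 (C : fieldType) (x y : C) : 'M[C]_2 :=
  diag_mx (\row_i (if i == 0 then x else y)).

Lemma diag2_unit (C : fieldType) (x y : C) :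
  x != 0 -> y != 0 -> diag2 x y \in unitmx.
Proof.
move=> x0 y0; rewrite unitmxE det_diag unitfE prodf_seq_neq0.
by apply/allP => i _; rewrite mxE; case: ifP.
Qed.

Lemma delta_diag2 (C : fieldType) (x y : C) i :
  (delta_mx 0 i : 'rV[C]_2) *m diag2 x y
  = (if i == 0 then x else y) *: delta_mx 0 i.
Proof.
apply/rowP => j; rewrite mul_mx_diag !mxE /= mulrC.
by have [->|_] := eqVneq j i; rewrite ?mulr0.
Qed.

(** * Trees with two separated markings *)

Lemma card_edges (V : finType) (e : rel V) :
  #|[set p : V * V | e p.1 p.2]| = (\sum_v #|[set w | e v w]|)%N.
Proof.
rewrite -sum1_card.
under [RHS]eq_bigr => v _ do rewrite -sum1_card.
by rewrite pair_big_dep /=; apply: eq_bigl => p; rewrite !inE.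
Qed.

(** A vertex other than v0 carries at most one marking, so stability gives it
    degree at least 2.  If there is such a vertex then v0 has degree at least 1
    by connectedness, and the degree sum exceeds twice the number of edges of a
    tree. *)
Lemma marked_tree_single (V : finType) (e : rel V) (mk : 'I_2 -> V) (v0 : V) :
  is_tree e ->
  (forall v, v != v0 ->
     (3 <= #|[set w | e v w]| + #|[set i | mk i == v]|)%N) ->
  (forall v, v != v0 -> mk 0 = v -> mk 1 <> v) ->
  forall v, v = v0.
Proof.
case=> _ _ _ conn card_e stab sep v; apply/eqP/negPn/negP => neq_v.
have val2 w : w != v0 -> (2 <= #|[set x | e w x]|)%N.
  move=> neq_w; have := stab w neq_w.
  suff : (#|[set i | mk i == w]| <= 1)%N by lia.
  rewrite leqNgt; apply/negP => card2.
  have /setP full : [set i | mk i == w] = setT.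
    by apply/eqP; rewrite eqEcard subsetT cardsT card_ord.
  have /eqP mk0 : mk 0 == w by have := full 0; rewrite !inE.
  have /eqP mk1 : mk 1 == w by have := full 1; rewrite !inE.
  exact: sep neq_w mk0 mk1.
have val1 : (1 <= #|[set x | e v0 x]|)%N.
  have /connectP[[|x s] /=] := conn v0 v.
    by move=> _ eq_v; rewrite eq_v eqxx in neq_v.
  by case/andP=> ex _ _; apply/card_gt0P; exists x; rewrite inE.
move: card_e; rewrite card_edges (bigD1 v0) //= => card_e.
(* The degrees add up to at least 2 (#|V| - 1) + 1. *)
have : (\sum_(w | w != v0) 2 <= \sum_(w | w != v0) #|[set x | e w x]|)%N.
  exact: leq_sum.
rewrite sum_nat_const cardC1 muln2 -card_e -[leqRHS]add0n leq_add2r.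
by rewrite leqNgt val1.
Qed.

(** * Rational functions with a scaling symmetry *)

Definition scale_arg (C : fieldType) (mu : C) (p : {poly C}) : {poly C} :=
  \poly_(i < size p) (p`_i * mu ^+ i).

Lemma horner_scale_arg (C : fieldType) (mu z : C) (p : {poly C}) :
  (scale_arg mu p).[z] = p.[mu * z].
Proof.
rewrite horner_poly horner_coef; apply: eq_bigr => i _.
by rewrite exprMn mulrA.
Qed.

Lemma coef_scale_arg (C : fieldType) (mu : C) (p : {poly C}) i :
  (scale_arg mu p)`_i = p`_i * mu ^+ i.
Proof.
rewrite coef_poly; case: ltnP => // le_pi.
by rewrite nth_default ?mul0r.
Qed.

Lemma size_scale_arg (C : fieldType) (mu : C) (p : {poly C}) :
  mu != 0 -> size (scale_arg mu p) = size p.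
Proof.
move=> mu0; have [->|p0] := eqVneq p 0.
  by rewrite /scale_arg size_poly0 poly_def big_ord0 size_poly0.
by rewrite size_poly_eq // mulf_neq0 ?expf_neq0 // -lead_coefE lead_coef_eq0.
Qed.

(** Having the same size, p and p(mu X) are then proportional. *)
Lemma dvdp_scale_arg (C : fieldType) (mu : C) (p : {poly C}) :
  mu != 0 -> p != 0 -> p %| scale_arg mu p ->
  exists c, forall i, p`_i != 0 -> mu ^+ i = c.
Proof.
move=> mu0 p0 /dvdp_size_eqp; rewrite size_scale_arg // eqxx => /esym/eqpf_eq.
case=> c c0 eq_p; exists c^-1 => i pi0.
have := congr1 (fun q : {poly C} => q`_i) eq_p.
rewrite coefZ coef_scale_arg => eq_pi.
apply: (mulfI c0); rewrite divff //; apply: (mulfI pi0).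
by rewrite mulr1 [RHS]eq_pi; ring.
Qed.

(** The hypothesis says that f = q / p satisfies f(mu z) = lam f(z).  By
    coprimality p and q are each proportional to their rescalings, so mu^i is
    constant, equal to some cp, resp. cq, over the exponents i that occur in p,
    resp. q.  Two distinct exponents in either of them would give
    a relation lam^i = 1. *)
Lemma rigid_fraction (C : fieldType) (lam mu : C) (p q : {poly C}) :
  mu != 0 -> (forall i, (0 < i)%N -> lam ^+ i != 1) ->
  coprimep p q -> p.[0] != 0 -> q != 0 ->
  p * scale_arg mu q = lam *: (q * scale_arg mu p) ->
  p = (p`_0)%:P /\ exists j, q = q`_j *: 'X^j.
Proof.
move=> mu0 lam1 co_pq p00 q0 eq_pq.
have p0 : p != 0 by apply: contraNneq p00 => ->; rewrite horner0.
have p_0 : p`_0 != 0 by rewrite -horner_coef0.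
have lam0 : lam != 0.
  apply: contraTneq isT => lam0; move/eqP: eq_pq.
  rewrite lam0 scale0r mulf_eq0 (negPf p0) -size_poly_eq0 size_scale_arg //.
  by rewrite size_poly_eq0 (negPf q0).
have [cq cqE] : exists c, forall i, q`_i != 0 -> mu ^+ i = c.
  apply: dvdp_scale_arg => //.
  rewrite -(@Gauss_dvdpr _ _ p) ?eq_pq; last by rewrite coprimep_sym.
  by rewrite dvdpZr // dvdp_mulr.
have [cp cpE] : exists c, forall i, p`_i != 0 -> mu ^+ i = c.
  apply: dvdp_scale_arg => //.
  rewrite -(@Gauss_dvdpr _ _ q) // -(@dvdpZr _ lam) // -eq_pq dvdp_mulr //.
(* The constant term of p forces cp = 1, and comparing both sides cq = lam. *)
have cp1 : cp = 1 by rewrite -(cpE 0%N) // expr0.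
have scale_p : scale_arg mu p = p.
  apply/polyP => i; rewrite coef_scale_arg.
  by have [->|/cpE->] := eqVneq p`_i 0; rewrite ?mul0r // cp1 mulr1.
have scale_q : scale_arg mu q = cq *: q.
  apply/polyP => i; rewrite coef_scale_arg coefZ mulrC.
  by have [->|/cqE->] := eqVneq q`_i 0; rewrite ?mulr0.
have cq_lam : cq = lam.
  have : (cq - lam) *: (p * q) == 0.
    by rewrite scalerBl subr_eq0 scalerAr -scale_q eq_pq scale_p [q * p]mulrC.
  by rewrite scaler_eq0 mulf_eq0 (negPf p0) (negPf q0) !orbF subr_eq0 => /eqP.
pose j := (size q).-1.
have qj0 : q`_j != 0 by rewrite -lead_coefE lead_coef_eq0.
have muj := cqE j qj0; split; last first.
  exists j; apply/polyP => i; rewrite coefZ coefXn.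
  have [->|neq_ij] := eqVneq i j; first by rewrite mulr1.
  rewrite mulr0; apply/eqP/negPn/negP => qi0; have mui := cqE i qi0.
  have lt_ij : (i < j)%N.
    have : (i < size q)%N.
      by rewrite ltnNge; apply: contra qi0 => /(nth_default 0)->.
    by rewrite /j in neq_ij *; lia.
  have := lam1 (j - i)%N; rewrite subn_gt0 => /(_ lt_ij)/eqP[].
  rewrite -cq_lam -{1}muj -exprM mulnC exprM.
  have -> : mu ^+ (j - i) = 1.
    apply: (mulfI (expf_neq0 i mu0)).
    by rewrite -exprD subnKC 1?ltnW // muj mui mulr1.
  by rewrite expr1n.
apply/polyP => -[|i]; rewrite coefC //=.
apply/eqP/negPn/negP => pi0; have mui := cpE _ pi0; rewrite cp1 in mui.
have /eqP[] := lam1 i.+1 isT.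
by rewrite -cq_lam -muj -exprM mulnC exprM mui expr1n.
Qed.

(** In the coordinates in which pa = [1:0] and pb = [0:1] the automorphism g
    lifting the torus action is z |-> (be / al) z, and [rigid_fraction] applies
    to F_b / F_a.  It remains to rescale both coordinates by d-th roots. *)
Lemma rigid_line_map (C : numClosedFieldType) (n d : nat)
  (F : 'I_n.+1 -> {mpoly C[2]}) (a b : 'I_n.+1) (pa pb : 'rV[C]_2) :
  a != b -> (0 < d)%N -> is_lift d F ->
  (forall Z, on_line a b (ev_forms F Z)) -> pa != 0 -> pb != 0 ->
  proj_eq (ev_forms F pa) (qpt C a) -> proj_eq (ev_forms F pb) (qpt C b) ->
  (forall t, in_torus t -> exists g : 'M[C]_2,
     [/\ proj_eq pa (pa *m g), proj_eq pb (pb *m g) &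
         forall Z, Z != 0 -> proj_eq (ev_forms F (Z *m g))
                                     (ev_forms (torus_act_forms t F) Z)]) ->
  exists g : 'M[C]_2,
    [/\ g \in unitmx, proj_eq (delta_mx 0 0) (pa *m g),
        proj_eq (delta_mx 0 1) (pb *m g) &
        forall Z, Z != 0 -> proj_eq (ev_forms (edge_forms C d a b) (Z *m g))
                                    (ev_forms F Z)].
Proof.
move=> neq_ab d_gt0 [homog_F F_n0] line_F pa0 pb0.
move=> /proj_eq_qpt[Fa_pa Fpa] /proj_eq_qpt[Fb_pb Fpb] fixed.
have neq_ba : b != a by rewrite eq_sym.
have := Fpa b neq_ba; have := Fpb a neq_ab.
move: Fa_pa Fb_pb; rewrite !mxE => Fa_pa Fb_pb Fa_pb Fb_pa.
have indep : ~ proj_eq pa pb.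
  case=> c c0 eq_pb; move/eqP: Fb_pb; apply.
  by rewrite eq_pb (meval_homog _ _ (homog_F b)) Fb_pa mulr0.
have B_unit := pair_mx_unit pa0 pb0 indep.
have comb_n0 z : pa + z *: pb != 0.
  rewrite -[pa]scale1r addrC; apply/eqP => comb0; case: indep.
  have [z0|z0] := eqVneq z 0.
    by move/eqP: comb0; rewrite z0 scale0r add0r scale1r (negPf pa0).
  exists (- z^-1); first by rewrite oppr_eq0 invr_eq0.
  move/eqP: comb0; rewrite addr_eq0 scale1r => /eqP comb0.
  by rewrite -[pa]opprK -comb0 scalerN scaleNr opprK scalerA mulVf // scale1r.
have [P size_P PE] := meval_pencil pa pb (homog_F a).
have [Q size_Q QE] := meval_pencil pa pb (homog_F b).
have at_pa f : f.@[pa 0] = f.@[(1 *: pa + 0 *: pb) 0].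
  by rewrite scale1r scale0r addr0.
have at_pb f : f.@[pb 0] = f.@[(0 *: pa + 1 *: pb) 0].
  by rewrite scale1r scale0r add0r.
move: Fa_pa Fb_pb Fa_pb Fb_pa; rewrite !at_pa !at_pb !PE !QE.
rewrite !homogenize0l !homogenize0r expr1n !mulr1 => P0 Qd Pd Q0.
have on_chart z : (F a).@[(pa + z *: pb) 0] = P.[z]
    /\ (F b).@[(pa + z *: pb) 0] = Q.[z].
  rewrite -[pa in (pa + _)]scale1r PE QE !homogenize_chart ?oner_neq0 //.
  by rewrite expr1n !mul1r divr1.
(* For this t the ratio t_a / t_b = 2 is no root of unity. *)
pose t j : C := if j == a then 1 else 2^-1.
have t_torus : in_torus t.
  by rewrite /t => j; case: ifP; rewrite ?oner_neq0 // invr_eq0 pnatr_eq0.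
have [g [[al al0 pa_g] [be be0 pb_g] F_g]] := fixed t t_torus.
have eq_PQ : P * scale_arg (be / al) Q = 2 *: (Q * scale_arg (be / al) P).
  apply: poly_eq_punctured => z _.
  rewrite hornerZ !hornerM !horner_scale_arg.
  have [c c0 /rowP eq_c] := F_g _ (comb_n0 z).
  have := eq_c b; have := eq_c a; rewrite !mxE /torus_act_forms !mevalZ.
  have [-> ->] := on_chart z.
  have -> : (pa + z *: pb) *m g = al *: pa + (z * be) *: pb.
    by rewrite mulmxDl -scalemxAl pa_g pb_g scalerA.
  rewrite PE QE !homogenize_chart // /t eqxx (negPf neq_ba) invr1 invrK mul1r.
  have -> : z * be / al = be / al * z by ring.
  move=> eq_P eq_Q; apply: (mulfI (mulf_neq0 c0 (expf_neq0 d al0))).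
  transitivity (P.[z] * (c * (al ^+ d * Q.[be / al * z]))); first by ring.
  by rewrite -eq_Q {1}eq_P; ring.
have [P_cst [j Q_mon]] : P = (P`_0)%:P /\ exists j, Q = Q`_j *: 'X^j.
  apply: (@rigid_fraction _ 2 (be / al)) => //.
  - by rewrite mulf_neq0 ?invr_eq0.
  - move=> [//|i] _; rewrite -natrX pnatr_eq1 expnS.
    by case: (2 ^ i)%N => // ?; rewrite mul2n.
  - apply/Pdiv.ClosedField.coprimepP => z /eqP Pz; apply/eqP => Qz.
    move/eqP: (F_n0 _ (comb_n0 z)); apply; apply/rowP => i; rewrite !mxE.
    have [->|neq_ia] := eqVneq i a; first by rewrite (on_chart z).1 Pz.
    have [->|neq_ib] := eqVneq i b; first by rewrite (on_chart z).2 Qz.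
    by have := line_F (pa + z *: pb) i neq_ia neq_ib; rewrite mxE.
  - by rewrite horner_coef0.
  - by apply: contraNneq Qd => ->; rewrite coef0.
have eq_jd : j = d.
  apply/eqP; move: Qd; rewrite {1}Q_mon coefZ coefXn.
  by have [_|_] := eqVneq d j; rewrite ?mulr0 ?eqxx.
rewrite {j}eq_jd in Q_mon.
have Fa_pencil x y : (F a).@[(x *: pa + y *: pb) 0] = P`_0 * x ^+ d.
  rewrite PE P_cst /homogenize big_ord_recl /= subn0 mulr1 big1 ?addr0 //.
  by move=> i _; rewrite coefC /= !mul0r.
have Fb_pencil x y : (F b).@[(x *: pa + y *: pb) 0] = Q`_d * y ^+ d.
  rewrite QE /homogenize big_ord_recr /= subnn mulr1 big1 ?add0r // => i _.
  by rewrite Q_mon coefZ coefXn ltn_eqF // mulr0 !mul0r.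
pose ra := d.-root P`_0; pose rb := d.-root Q`_d.
have ra0 : ra != 0 by rewrite rootC_eq0.
have rb0 : rb != 0 by rewrite rootC_eq0.
pose D := diag2 ra rb; have D_unit := diag2_unit ra0 rb0.
pose h := invmx (pair_mx pa pb) *m D.
have pa_B : pa *m invmx (pair_mx pa pb) = delta_mx 0 0.
  apply: (canLR (mulmxK B_unit)).
  by rewrite mul_pair_mx !mxE /= scale1r scale0r addr0.
have pb_B : pb *m invmx (pair_mx pa pb) = delta_mx 0 1.
  apply: (canLR (mulmxK B_unit)).
  by rewrite mul_pair_mx !mxE /= scale1r scale0r add0r.
exists h; split.
- by rewrite unitmx_mul unitmx_inv B_unit.
- by exists ra => //; rewrite mulmxA pa_B delta_diag2.
- by exists rb => //; rewrite mulmxA pb_B delta_diag2.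
move=> Z _; exists 1; rewrite ?oner_neq0 // scale1r; apply/rowP => j.
rewrite !mxE; set u := Z *m invmx (pair_mx pa pb).
have -> : Z = u 0 0 *: pa + u 0 1 *: pb by rewrite -mul_pair_mx mulmxKV.
have hE i : ((u 0 0 *: pa + u 0 1 *: pb) *m h) 0 i
    = u 0 i * (if i == 0 then ra else rb).
  by rewrite -mul_pair_mx mulmxA mulmxK // mul_mx_diag !mxE.
rewrite /edge_forms; have [->|neq_ja] := eqVneq j a.
  by rewrite Fa_pencil rmorphXn /= mevalXU hE eqxx exprMn rootCK // mulrC.
have [->|neq_jb] := eqVneq j b.
  by rewrite Fb_pencil rmorphXn /= mevalXU hE /= exprMn rootCK // mulrC.
have := line_F (u 0 0 *: pa + u 0 1 *: pb) j neq_ja neq_jb.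
by rewrite mxE meval0.
Qed.

(** * The fixed component is a point *)

Lemma edge_form_a (C : fieldType) n d (a b : 'I_n.+1) (Z : 'rV[C]_2) :
  (edge_forms C d a b a).@[Z 0] = Z 0 0 ^+ d.
Proof. by rewrite /edge_forms eqxx rmorphXn /= mevalXU. Qed.

Lemma edge_form_b (C : fieldType) n d (a b : 'I_n.+1) (Z : 'rV[C]_2) :
  b != a -> (edge_forms C d a b b).@[Z 0] = Z 0 1 ^+ d.
Proof.
move=> neq_ba.
by rewrite /edge_forms (negPf neq_ba) eqxx rmorphXn /= mevalXU.
Qed.

Lemma edge_form_other (C : fieldType) n d (a b j : 'I_n.+1) :
  j != a -> j != b -> edge_forms C d a b j = 0.
Proof.
by move=> /negPf ja /negPf jb; rewrite /edge_forms ja jb.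
Qed.

Lemma ev_edge_neq0 (C : fieldType) n d (a b : 'I_n.+1) (Z : 'rV[C]_2) :
  a != b -> Z != 0 -> ev_forms (edge_forms C d a b) Z != 0.
Proof.
rewrite eq_sym => neq_ba /rV2_neq0 Z0; apply/eqP => /rowP ev0.
have := ev0 a; have := ev0 b; rewrite !mxE edge_form_a edge_form_b //.
move=> /eqP; rewrite expf_eq0 => /andP[_ Z01].
move=> /eqP; rewrite expf_eq0 => /andP[_ Z00].
by case: Z0; [rewrite Z00|rewrite Z01].
Qed.

Lemma edge_is_lift (C : fieldType) n d (a b : 'I_n.+1) :
  a != b -> is_lift d (edge_forms C d a b).
Proof.
move=> neq_ab; split=> [j|Z]; last exact: ev_edge_neq0.
rewrite /edge_forms.
have homog_X i : ('X_i ^+ d : {mpoly C[2]}) \is d.-homog.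
  by rewrite -[d in d.-homog]mul1n; apply: dhomogMn; rewrite dhomogX /= mdeg1.
by case: ifP => // _; case: ifP => // _; apply: dhomog0.
Qed.

Lemma ev_edge_delta (C : fieldType) n d (a b : 'I_n.+1) (i : 'I_2) :
  a != b -> (0 < d)%N ->
  ev_forms (edge_forms C d a b) (delta_mx 0 i)
  = qpt C (if i == 0 then a else b).
Proof.
move=> neq_ab d_gt0; apply/rowP => j; rewrite !mxE eqxx /=.
have [->|neq_ja] := eqVneq j a.
  rewrite edge_form_a !mxE /= eq_sym; case: ifP => _; rewrite ?expr1n ?eqxx //.
  by rewrite expr0n eqn0Ngt d_gt0 (negPf neq_ab).
have [->|neq_jb] := eqVneq j b.
  rewrite edge_form_b ?mxE 1?eq_sym //=.
  case: (eqVneq i 0) => [->|/ord2_neq0->] /=.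
    by rewrite expr0n eqn0Ngt d_gt0 eq_sym (negPf neq_ab).
  by rewrite expr1n eqxx.
rewrite edge_form_other // meval0.
by case: ifP => _; rewrite ?(negPf neq_ja) ?(negPf neq_jb).
Qed.

Lemma is_tree_unit : is_tree (fun _ _ : unit => false).
Proof.
split=> //; first by rewrite card_unit.
  by case=> -[]; apply: connect0.
rewrite card_unit; apply/eqP; rewrite cards_eq0; apply/eqP/setP => p.
by rewrite !inE.
Qed.

Lemma edge_map_in_M_Gamma (C : numClosedFieldType) n d (a b : 'I_n.+1)
  (A : {set 'I_2}) :
  a != b -> (0 < d)%N -> (0 \in A) != (1 \in A) ->
  in_M_Gamma d a b A (edge_map C d a b A).
Proof.
move=> neq_ab d_gt0 sepA; have neq_ba : b != a by rewrite eq_sym.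
split.
- split=> //=.
  + split; first exact: is_tree_unit.
    split=> //=; first by split=> // i; apply: delta_mx_neq0.
    move=> i j neq_ij _ [c c0].
    have sep_ij : (i \in A) != (j \in A).
      move: neq_ij; have [->|/ord2_neq0->] := eqVneq i 0;
        have [->|/ord2_neq0->] := eqVneq j 0 => // _.
      by rewrite eq_sym.
    rewrite /edge_mpt; move: sep_ij; case: (i \in A); case: (j \in A) => // _.
      by move/rowP/(_ 1)/eqP; rewrite !mxE /= mulr0 oner_eq0.
    by move/rowP/(_ 0)/eqP; rewrite !mxE /= mulr0 oner_eq0.
  + by move=> v; apply: edge_is_lift.
  + by move=> v d0; move: d_gt0; rewrite d0.
  + by rewrite (bigD1 tt) //= big1 ?addn0 // => -[].
- move=> t t_torus; exists id.
  pose x := d.-root (t a)^-1; pose y := d.-root (t b)^-1.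
  have x0 : x != 0 by rewrite rootC_eq0 // invr_eq0.
  have y0 : y != 0 by rewrite rootC_eq0 // invr_eq0.
  exists (fun=> diag2 x y); split=> //=.
  + by split=> [|_]; [exists id|apply: diag2_unit].
  + move=> i; split=> //; rewrite /edge_mpt.
    by eexists; last exact: delta_diag2; case: ifP.
  move=> _ Z _; exists 1; rewrite ?oner_neq0 // scale1r.
  apply/rowP => j; rewrite !mxE /torus_act_forms mevalZ.
  have [->|neq_ja] := eqVneq j a.
    by rewrite !edge_form_a mul_mx_diag !mxE exprMn rootCK // mulrC.
  have [->|neq_jb] := eqVneq j b.
    by rewrite !edge_form_b // mul_mx_diag !mxE exprMn rootCK // mulrC.
  by rewrite edge_form_other // !meval0 mulr0.
- exists tt; split=> //=.
    by move=> Z j neq_ja neq_jb; rewrite mxE edge_form_other // meval0.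
  move=> x x0 line_x.
  pose Z : 'rV[C]_2 := \row_i d.-root (x 0 (if i == 0 then a else b)).
  have ZE : ev_forms (edge_forms C d a b) Z = x.
    apply/rowP => j; rewrite !mxE.
    have [->|neq_ja] := eqVneq j a; first by rewrite edge_form_a !mxE rootCK.
    have [->|neq_jb] := eqVneq j b; first by rewrite edge_form_b // !mxE rootCK.
    by rewrite edge_form_other // meval0 line_x.
  exists Z; last by rewrite ZE; apply: proj_eq_refl.
  apply: contraNneq x0 => Z0; rewrite -ZE Z0; apply/eqP/rowP => j; rewrite !mxE.
  have [->|neq_ja] := eqVneq j a.
    by rewrite edge_form_a mxE expr0n eqn0Ngt d_gt0.
  have [->|neq_jb] := eqVneq j b; last by rewrite edge_form_other // meval0.
  by rewrite edge_form_b // mxE expr0n eqn0Ngt d_gt0.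
- move=> i /=; rewrite /edge_mpt ev_edge_delta //.
  by case: (i \in A); apply: proj_eq_refl.
Qed.

(** A contracted component is mapped to a single point, so it cannot carry both
    markings, whose images q_a and q_b differ. *)
Lemma in_M_Gamma_single (C : fieldType) n d (a b : 'I_n.+1) (A : {set 'I_2})
  (X : map_data C n 2) (v0 : sm_comp X) :
  a != b -> (0 \in A) != (1 \in A) -> is_stable_map d X ->
  (forall v, v != v0 -> sm_deg v = 0%N) ->
  (forall i, proj_eq (ev_forms (sm_map (sm_mark X i)) (sm_mpt X i))
                     (qpt C (if i \in A then a else b))) ->
  forall v, v = v0.
Proof.
move=> neq_ab sepA [[tree _] lift _ stab _] deg0 marks.
apply: (@marked_tree_single _ _ (sm_mark X)) tree _ _
  => [v /deg0|v neq_v mk0 mk1].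
  exact: stab.
have [homog_v _] := lift v; rewrite deg0 // in homog_v.
have := marks 0; have := marks 1; rewrite mk0 mk1.
rewrite (_ : ev_forms _ (sm_mpt X 1)
             = ev_forms (sm_map v) (sm_mpt X 0)); last first.
  by apply/rowP => j; rewrite !mxE; apply: meval_deg0.
move=> /proj_eq_qpt[n1 z1] /proj_eq_qpt[n0 z0].
have neq_q : (if 0 \in A then a else b) != (if 1 \in A then a else b).
  by move: sepA; case: (0 \in A); case: (1 \in A) => // _; rewrite eq_sym.
by move/eqP: n0; apply; apply: z1.
Qed.

Lemma M_Gamma_point (C : numClosedFieldType) n d (a b : 'I_n.+1)
  (A : {set 'I_2}) (X : map_data C n 2) :
  a != b -> (0 < d)%N -> (0 \in A) != (1 \in A) ->
  in_M_Gamma d a b A X -> stable_map_iso X (edge_map C d a b A).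
Proof.
move=> neq_ab d_gt0 sepA [stabX fixX [v0 [deg_v0 deg0 line_v0 _]] marks].
have single := in_M_Gamma_single neq_ab sepA stabX deg0 marks.
have [[[_ irr _ _ _] [[_ mpt0] _ _ _]] lift _ _ _] := stabX.
have adjF v w : sm_adj (m := X) v w = false.
  by rewrite (single v) (single w) irr.
pose ia : 'I_2 := if 0 \in A then 0 else 1.
pose ib : 'I_2 := if 0 \in A then 1 else 0.
have iaA : ia \in A.
  by move: sepA; rewrite /ia; case: ifP => // _; case: (1 \in A).
have ibA : ib \in A = false.
  by move: sepA; rewrite /ib; case: ifP => //; case: (1 \in A).
have [g [g_unit pa_g pb_g F_g]] : exists g : 'M[C]_2,
    [/\ g \in unitmx, proj_eq (delta_mx 0 0) (sm_mpt X ia *m g),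
        proj_eq (delta_mx 0 1) (sm_mpt X ib *m g) &
        forall Z, Z != 0 -> proj_eq (ev_forms (edge_forms C d a b) (Z *m g))
                                    (ev_forms (sm_map v0) Z)].
  apply: rigid_line_map => //.
  - by have := lift v0; rewrite deg_v0.
  - by have := marks ia; rewrite iaA (single (sm_mark X ia)).
  - by have := marks ib; rewrite ibA (single (sm_mark X ib)).
  move=> t /fixX[f [g [_ _ _ mark_g map_g]]].
  exists (g v0); split.
  - by have [_] := mark_g ia; rewrite /= (single (sm_mark X ia)).
  - by have [_] := mark_g ib; rewrite /= (single (sm_mark X ib)).
  by move=> Z Z0; have := map_g v0 Z Z0; rewrite /= (single (f v0)).
exists (fun=> tt); exists (fun=> g); split=> //=.
- by split=> //; exists (fun=> v0) => [v|[]//]; rewrite (single v).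
- by move=> v w; rewrite adjF.
- move=> i; split=> //; rewrite /edge_mpt.
  have [iA|iA] := boolP (i \in A).
    rewrite (_ : i = ia) //; apply/eqP; move: iA ibA; rewrite /ia /ib.
    by have [->|/ord2_neq0->] := eqVneq i 0; case: (0 \in A) => // ->.
  rewrite (_ : i = ib) //; apply/eqP; move: iA iaA; rewrite /ia /ib.
  by have [->|/ord2_neq0->] := eqVneq i 0; case: (0 \in A) => // /negPf->.
by move=> v Z Z0; rewrite (single v); apply: F_g.
Qed.

(** * Sections as tuples of binary forms *)

(** The surjectivity part, which rests on H^1(O(-1)) = 0.  The local lifts u, u'
    of a section to (n+1)-tuples differ on the overlap by a multiple c of F.
    Away from a, b the entries glue to forms of degree N.  Taking the
    determinant with F = (Z_0^{N+1}, Z_1^{N+1}) eliminates c from the entries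
    a, b and leaves a form g of degree 2N+1; splitting its monomials into the
    multiples of Z_1^{N+1} and of Z_0^{N+1} gives the two entries of the global
    lift. *)
Lemma section_by_forms (C : numFieldType) n N (a b : 'I_n.+1)
  (sigma : 'rV[C]_2 -> 'rV[C]_n.+1) :
  a != b -> is_section N.+1 (edge_forms C N.+1 a b) sigma ->
  exists2 G : 'I_n.+1 -> {poly C}, (forall m, (size (G m) <= N.+1)%N) &
    forall Z : 'rV[C]_2, Z != 0 -> exists c : C,
      sigma Z = \row_m homogenize N (G m) (Z 0 0) (Z 0 1)
                + c *: ev_forms (edge_forms C N.+1 a b) Z.
Proof.
move=> neq_ab [[u uE] [u' u'E]]; have neq_ba : b != a by rewrite eq_sym.
pose F := edge_forms C N.+1 a b.
have overlap z : z != 0 -> exists c, forall m, (u m).[z] =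
    z ^+ N * (u' m).[z^-1] + c * (F m).@[(\row_i (if i == 0 then 1 else z)) 0].
  move=> z0; pose Z : 'rV[C]_2 := \row_i (if i == 0 then 1 else z).
  have [c1 /rowP Z1] : exists c : C, sigma Z
      = \row_m (u m).[z] + c *: ev_forms F Z.
    have Z00 : Z 0 0 != 0 by rewrite mxE /= oner_neq0.
    have [c ->] := uE Z Z00; exists c.
    by rewrite !mxE /= expr1n !divr1 scale1r.
  have [c2 /rowP Z2] : exists c : C, sigma Z
      = z ^+ N *: \row_m (u' m).[z^-1] + c *: ev_forms F Z.
    have Z01 : Z 0 1 != 0 by rewrite mxE.
    have [c ->] := u'E Z Z01; exists c.
    by rewrite !mxE /= exprSr mulfK // div1r.
  exists (c2 - c1) => m; have := Z1 m; rewrite Z2 !mxE => /eqP.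
  by rewrite mulrBl addrA -subr_eq => /eqP.
have other m : m != a -> m != b ->
    (size (u m) <= N.+1)%N /\ (u' m).[0] = (u m)`_N.
  move=> ma mb; apply: pole_bound => z /overlap[c ->].
  by rewrite /F edge_form_other // meval0 mulr0 addr0.
(* Both g and h are free of the indeterminate multiple c of F. *)
pose g := u b - 'X^(N.+1) * u a.
pose h := 'X^(N.+1) * u' b - u' a.
have [size_g h0] : (size g <= (N + N.+1).+1)%N /\ h.[0] = g`_(N + N.+1).
  apply: pole_bound => z z0; have [c cE] := overlap z z0.
  rewrite !(hornerE, hornerXn) !cE /F edge_form_a edge_form_b // !mxE /= expr1n.
  by rewrite exprD exprVn; field; rewrite expf_neq0.
have u'a0 : (u' a).[0] = - g`_(N + N.+1).
  by rewrite -h0 !(hornerE, hornerXn) expr0n mul0r sub0r opprK.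
pose G m := if m == a then - drop_poly N.+1 g
            else if m == b then take_poly N.+1 g else u m.
have Ga : G a = - drop_poly N.+1 g by rewrite /G eqxx.
have Gb : G b = take_poly N.+1 g by rewrite /G (negPf neq_ba) eqxx.
have Gm m : m != a -> m != b -> G m = u m by rewrite /G => /negPf-> /negPf->.
have size_G m : (size (G m) <= N.+1)%N.
  have [->|ma] := eqVneq m a.
    by rewrite Ga size_polyN size_drop_poly leq_subLR addSn.
  have [->|mb] := eqVneq m b; first by rewrite Gb size_take_poly.
  by rewrite Gm // (other m ma mb).1.
have G_glue z : (G b).[z] - z ^+ N.+1 * (G a).[z]
    = (u b).[z] - z ^+ N.+1 * (u a).[z].
  transitivity g.[z]; last by rewrite !(hornerE, hornerXn).
  rewrite Ga Gb -[in RHS](poly_take_drop N.+1 g) !(hornerE, hornerXn).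
  by ring.
exists G => // Z /rV2_neq0 Z_n0; have [x0|x0] := eqVneq (Z 0 0) 0.
  have y0 : Z 0 1 != 0 by case: Z_n0 => //; rewrite x0 eqxx.
  have [c ->] := u'E Z y0.
  (* At [0:1] the form F_a vanishes, so c is adjusted by the entry b. *)
  exists (c + ((u' b).[0] - (G b)`_N) / Z 0 1); apply/rowP => m; rewrite !mxE.
  rewrite x0 homogenize0l mul0r exprSr mulfK //.
  have [->|ma] := eqVneq m a.
    rewrite Ga coefN coef_drop_poly u'a0 edge_form_a x0 expr0n /= !mulr0 !addr0.
    exact: mulrC.
  have [->|mb] := eqVneq m b; last first.
    rewrite Gm // edge_form_other // meval0 !mulr0 !addr0.
    by rewrite (other m ma mb).2 mulrC.
  by rewrite edge_form_b // exprSr; field.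
have [c ->] := uE Z x0.
exists (c + ((u a).[Z 0 1 / Z 0 0] - (G a).[Z 0 1 / Z 0 0]) / Z 0 0).
apply/rowP => m; rewrite !mxE homogenize_chart // exprSr mulfK //.
have [->|ma] := eqVneq m a; first by rewrite edge_form_a exprSr; field.
have [->|mb] := eqVneq m b; last first.
  by rewrite Gm // edge_form_other // meval0 !mulr0 !addr0.
rewrite edge_form_b //; have := G_glue (Z 0 1 / Z 0 0).
set z := Z 0 1 / Z 0 0; move/eqP; rewrite subr_eq => /eqP ->.
have -> : Z 0 1 = z * Z 0 0 by rewrite divfK.
by rewrite exprMn [Z 0 0 ^+ N.+1]exprSr; field.
Qed.

(** The injectivity part, which rests on H^0(O(-1)) = 0: forms of degree N that
    are proportional to F, of degree N+1 without common zero, vanish. *)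
Lemma forms_section_inj (C : numFieldType) n N (a b : 'I_n.+1)
  (G : 'I_n.+1 -> {poly C}) :
  a != b -> (forall m, (size (G m) <= N.+1)%N) ->
  (forall Z : 'rV[C]_2, Z != 0 -> exists c : C,
     \row_m homogenize N (G m) (Z 0 0) (Z 0 1)
     = c *: ev_forms (edge_forms C N.+1 a b) Z) ->
  forall m, G m = 0.
Proof.
move=> neq_ab size_G G_F; have neq_ba : b != a by rewrite eq_sym.
have chart z : exists c : C, forall m, (G m).[z] =
    c * (edge_forms C N.+1 a b m).@[(\row_i (if i == 0 then 1 else z)) 0].
  have [|c /rowP Z_c] := G_F (\row_i (if i == 0 then 1 else z)).
    by apply/eqP => /rowP/(_ 0)/eqP; rewrite !mxE /= oner_eq0.
  exists c => m; have := Z_c m.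
  by rewrite !mxE homogenize_chart ?oner_neq0 //= expr1n mul1r divr1.
have GbE : G b = G a * 'X^(N.+1).
  apply: poly_eq_punctured => z _; have [c cE] := chart z.
  rewrite hornerM hornerXn !cE edge_form_a edge_form_b // !mxE /= expr1n.
  by rewrite mulr1.
have Ga0 : G a = 0.
  apply/polyP => i; rewrite coef0.
  have <- : (G b)`_(i + N.+1) = (G a)`_i.
    by rewrite GbE coefMXn ltnNge leq_addl addnK.
  by rewrite nth_default // (leq_trans (size_G b)) ?leq_addl.
move=> m; have [->//|ma] := eqVneq m a.
have [->|mb] := eqVneq m b; first by rewrite GbE Ga0 mul0r.
apply: poly_eq_punctured => z _; have [c ->] := chart z.
by rewrite edge_form_other // meval0 mulr0 horner0.
Qed.

Lemma mderiv_exp (C : fieldType) k (p : {mpoly C[k]}) (i : 'I_k) N :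
  (p ^+ N.+1)^`M(i) = (p ^+ N * p^`M(i)) *+ N.+1.
Proof.
elim: N => [|N IH]; first by rewrite expr1 expr0 mul1r.
rewrite exprS mderivM IH mulrnAr mulrA -exprS [_ *+ N.+2]mulrS.
by rewrite [p^`M(i) * _]mulrC.
Qed.

Lemma meval_mderiv_XU (C : fieldType) (i j : 'I_2) (Z : 'rV[C]_2) :
  (('X_i)^`M(j)).@[Z 0] = (i == j)%:R.
Proof.
rewrite mderivX mevalZ mnmE mevalX.
have [->|_] := eqVneq i j; last by rewrite mul0r.
by rewrite mul1r big1 // => k _; rewrite mnmBE subnn expr0.
Qed.

(** The tuple of forms of degree N that represents <s, dphi>.  By Euler's
    identity Z_0 dphi and Z_1 dphi are, modulo F, the classes of
    (N+1) Z_1^N e_b and - (N+1) Z_0^N e_a. *)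
Definition contraction_lift (C : fieldType) n N (a b : 'I_n.+1) (s : 'cV[C]_2)
  (m : 'I_n.+1) : {poly C} :=
  if m == a then (- (s 1 0 * N.+1%:R))%:P
  else if m == b then (s 0 0 * N.+1%:R) *: 'X^N else 0.

Lemma contraction_liftE (C : fieldType) n N (a b : 'I_n.+1) (s : 'cV[C]_2)
  (Z w : 'rV[C]_2) :
  a != b -> Z 0 0 * w 0 1 - Z 0 1 * w 0 0 = 1 ->
  exists c : C, ev_lin s Z *: deriv_forms (edge_forms C N.+1 a b) Z w
    = \row_m homogenize N (contraction_lift N a b s m) (Z 0 0) (Z 0 1)
      + c *: ev_forms (edge_forms C N.+1 a b) Z.
Proof.
move=> neq_ab det_Zw; have neq_ba : b != a by rewrite eq_sym.
have sZ : ev_lin s Z = Z 0 0 * s 0 0 + Z 0 1 * s 1 0.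
  rewrite /ev_lin mxE 2!big_ord_recl big_ord0 addr0.
  by congr (_ + Z 0 _ * s _ 0); apply: val_inj.
exists (N.+1%:R * (s 0 0 * w 0 0 + s 1 0 * w 0 1)).
apply/rowP => m; rewrite !mxE sZ 2!big_ord_recl big_ord0 addr0.
have -> : lift ord0 ord0 = 1 :> 'I_2 by apply: val_inj.
rewrite /contraction_lift; have [->|ma] := eqVneq m a.
  rewrite edge_form_a /edge_forms eqxx !mderiv_exp !mevalMn !mevalM.
  rewrite !rmorphXn /= !mevalXU !meval_mderiv_XU /=.
  rewrite /homogenize big_ord_recl /= coefC /= subn0 big1; last first.
    by move=> i _; rewrite coefC /= !mul0r.
  move/eqP: det_Zw; rewrite subr_eq => /eqP E; rewrite exprSr.
  ring: E.
have [->|mb] := eqVneq m b.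
  rewrite edge_form_b // /edge_forms (negPf neq_ba) eqxx.
  rewrite !mderiv_exp !mevalMn !mevalM !rmorphXn /=.
  rewrite !mevalXU !meval_mderiv_XU /= /homogenize big_ord_recr /=.
  rewrite coefZ coefXn eqxx !mulr1 subnn expr0 big1; last first.
    by move=> i _; rewrite coefZ coefXn ltn_eqF // mulr0 !mul0r.
  move/eqP: det_Zw; rewrite subr_eq => /eqP E; rewrite exprSr.
  ring: E.
rewrite edge_form_other // !mderiv0 !meval0 /homogenize big1; last first.
  by move=> i _; rewrite coef0 !mul0r.
by rewrite !mulr0 !addr0 mulr0.
Qed.

Lemma deriv_direction (C : fieldType) (Z : 'rV[C]_2) :
  Z != 0 -> exists w : 'rV[C]_2, Z 0 0 * w 0 1 - Z 0 1 * w 0 0 = 1.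
Proof.
case/rV2_neq0 => Zi0.
  exists (\row_i (if i == 0 then 0 else (Z 0 0)^-1)).
  by rewrite !mxE /= mulr0 subr0 divff.
exists (\row_i (if i == 0 then - (Z 0 1)^-1 else 0)).
by rewrite !mxE /= mulr0 sub0r mulrN opprK divff.
Qed.

(** * The basis of monomial sections *)

Definition monomial_section (C : fieldType) n N (p : 'I_n.+1 * 'I_N.+1)
  (Z : 'rV[C]_2) : 'rV[C]_n.+1 :=
  (Z 0 0 ^+ p.2 * Z 0 1 ^+ (N - p.2)) *: delta_mx 0 p.1.

Definition section_vec (C : fieldType) n N (p : 'I_n.+1 * 'I_N.+1) :
  susy_ambient C n := (0, 0, @monomial_section C n N p).

Lemma section_vec_num (C : fieldType) n N (a b : 'I_n.+1) p :
  N_num N.+1 (edge_forms C N.+1 a b) (@section_vec C n N p).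
Proof.
case: p => m q; have le_qN : (q <= N)%N by rewrite -ltnS.
split.
  exists (fun j => if j == m then 'X^(N - q) else 0) => Z x0.
  exists 0; rewrite scale0r addr0; apply/rowP => j; rewrite !mxE /=.
  have [_|_] := eqVneq j m; last by rewrite horner0 !mulr0.
  rewrite mulr1 hornerXn exprSr mulfK // expr_div_n.
  have -> : Z 0 0 ^+ N = Z 0 0 ^+ q * Z 0 0 ^+ (N - q) by rewrite -exprD subnKC.
  by field; rewrite expf_neq0.
exists (fun j => if j == m then 'X^q else 0) => Z x0.
exists 0; rewrite scale0r addr0; apply/rowP => j; rewrite !mxE /=.
have [_|_] := eqVneq j m; last by rewrite horner0 !mulr0.
rewrite mulr1 hornerXn exprSr mulfK // expr_div_n.
have -> : Z 0 1 ^+ N = Z 0 1 ^+ q * Z 0 1 ^+ (N - q) by rewrite -exprD subnKC.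
by field; rewrite expf_neq0.
Qed.

(** [homogenize] indexes the coefficients by the exponent of Z_1, and
    [monomial_section] by that of Z_0: hence the reversal. *)
Definition forms_of (C : fieldType) n N (y : {ffun 'I_n.+1 * 'I_N.+1 -> C})
  (m : 'I_n.+1) : {poly C} := \poly_(i < N.+1) y (m, inord (N - i)).

Lemma sum_section_vec (C : fieldType) n N (y : {ffun 'I_n.+1 * 'I_N.+1 -> C}) :
  \sum_p y p *: section_vec C p =
  (0, 0, fun Z : 'rV[C]_2 =>
     \row_m homogenize N (forms_of y m) (Z 0 0) (Z 0 1)) :> susy_ambient C n.
Proof.
transitivity ((0, 0, \sum_p y p *: monomial_section p) : susy_ambient C n).
  elim/big_rec2: _ => [|p f x _ ->]; first by [].
  by congr (_, _, _); rewrite /= ?scaler0 ?addr0.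
congr (_, _, _); apply: boolp.funext => Z; rewrite fct_sumE; apply/rowP => m.
rewrite summxE mxE.
transitivity (\sum_m' \sum_q (y (m', q) *: monomial_section (m', q) Z) 0 m).
  by rewrite pair_bigA; apply: eq_bigr => -[].
rewrite (bigD1 m) //=.
rewrite [X in _ + X]big1 ?addr0 => [|m' neq_m]; last first.
  by rewrite big1 // => q _; rewrite !mxE /= eq_sym (negPf neq_m) !mulr0.
rewrite /homogenize (reindex_inj rev_ord_inj) /=; apply: eq_bigr => i _.
have le_iN : (i <= N)%N by rewrite -ltnS.
rewrite !mxE !eqxx /= mulr1 coef_poly ltn_ord subSS subKn //.
rewrite mulrA; congr (y (m, _) * _ * _); apply: val_inj.
by rewrite /= inordK ?subSS // ltnS leq_subr.
Qed.

Lemma ev_lin_delta (C : fieldType) (s : 'cV[C]_2) i :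
  ev_lin s (delta_mx 0 i) = s i 0.
Proof. by rewrite /ev_lin -rowE mxE. Qed.

(** The components of x in p_1^*S and p_2^*S determine the linear form s, so
    x is equivalent to the section x.2 + <s, dphi> in H^0(S^v (x) phi^*TP^n),
    and its coordinates are the coefficients of the unique tuple H of forms
    representing that section. *)
Lemma section_vec_basis (C : numFieldType) n N (a b : 'I_n.+1) (A : {set 'I_2})
  (x : susy_ambient C n) :
  a != b -> (0 \in A) != (1 \in A) ->
  N_num N.+1 (edge_forms C N.+1 a b) x ->
  exists! y : {ffun 'I_n.+1 * 'I_N.+1 -> C},
    N_den (edge_forms C N.+1 a b) (edge_mpt C A)
      (x - \sum_p y p *: section_vec C p).
Proof.
move=> neq_ab sepA x_sec.
have [G size_G G_x] := section_by_forms neq_ab x_sec.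
pose F := edge_forms C N.+1 a b.
pose i0 : 'I_2 := if 0 \in A then 0 else 1.
pose i1 : 'I_2 := if 1 \in A then 0 else 1.
have neq_i : i1 != i0.
  by move: sepA; rewrite /i0 /i1; case: (0 \in A); case: (1 \in A).
have i01 i : i != i0 -> i = i1.
  move: sepA; rewrite /i0 /i1; case: (0 \in A); case: (1 \in A) => // _.
    exact: ord2_neq0.
  by have [//|/ord2_neq0->] := eqVneq i 0.
pose s : 'cV[C]_2 := \col_i (if i == i0 then x.1.1 i 0 else x.1.2 i 0).
have ev_mpt s' : (ev_lin x.1.1 (edge_mpt C A 0) = ev_lin s' (edge_mpt C A 0) /\
    ev_lin x.1.2 (edge_mpt C A 1) = ev_lin s' (edge_mpt C A 1)) <-> s' = s.
  rewrite /edge_mpt !ev_lin_delta -/i0 -/i1; split=> [[eq0 eq1]|->].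
    apply/colP => i; rewrite mxE; have [->//|/i01->] := eqVneq i i0.
    by [].
  by rewrite !mxE eqxx (negPf neq_i).
pose H m := G m + contraction_lift N a b s m.
have size_H m : (size (H m) <= N.+1)%N.
  rewrite (leq_trans (size_polyD _ _)) // geq_max size_G /contraction_lift.
  case: ifP => _; first by rewrite (leq_trans (size_polyC_leq1 _)).
  case: ifP => _; last by rewrite size_poly0.
  by rewrite (leq_trans (size_scale_leq _ _)) // size_polyXn.
have den_iff (y : {ffun 'I_n.+1 * 'I_N.+1 -> C}) :
    N_den F (edge_mpt C A) (x - \sum_p y p *: section_vec C p) <->
    forall m, forms_of y m = H m.
  rewrite sum_section_vec; split.
    case=> s' []; rewrite /= !subr0 => eq0 eq1.
    have {eq0 eq1}-> : s' = s by apply/ev_mpt.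
    move=> contr m; apply/eqP; rewrite -subr_eq0; apply/eqP; move: m.
    apply: (@forms_section_inj _ n N a b) => // [m|Z Z0].
      rewrite (leq_trans (size_polyD _ _)) // geq_max size_polyN.
      by rewrite size_H size_poly.
    have [w det_Zw] := deriv_direction Z0.
    have [c1 c1E] := G_x Z Z0.
    have [c2 c2E] := contraction_liftE N s neq_ab det_Zw.
    have [c3 c3E] := contr Z w det_Zw.
    exists (c1 + c2 + c3); apply/rowP => m.
    have := congr1 (fun v : 'rV_n.+1 => v 0 m) c3E.
    rewrite c2E /= !fctE c1E !mxE !homogenizeB homogenizeD => E.
    by move/eqP: E; rewrite /F opprB subr_eq => /eqP->; ring.
  move=> yE; exists s; rewrite /= !subr0.
  have [_ /(_ erefl)[eq0 eq1]] := ev_mpt s.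
  split=> // Z w det_Zw.
  have Z0 : Z != 0.
    apply/eqP => Z0; move/eqP: det_Zw.
    by rewrite Z0 !mxE !mul0r subrr eq_sym oner_eq0.
  have [c1 c1E] := G_x Z Z0.
  have [c2 c2E] := contraction_liftE N s neq_ab det_Zw.
  exists (- c1 - c2); rewrite c2E /= !fctE c1E; apply/rowP => m.
  rewrite !mxE yE /H homogenizeD; ring.
exists [ffun p : 'I_n.+1 * 'I_N.+1 => (H p.1)`_(N - p.2)]; split.
  apply/den_iff => m; apply/polyP => i; rewrite coef_poly.
  case: ltnP => [lt_iN|le_Ni]; last first.
    by rewrite nth_default // (leq_trans (size_H m)).
  by rewrite ffunE /= inordK ?ltnS ?leq_subr // subKn.
move=> y /den_iff yE; apply/ffunP => -[m q]; rewrite ffunE /= -yE coef_poly.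
rewrite ltnS leq_subr subKn; last by rewrite -ltnS.
by congr (y (m, _)); apply: val_inj; rewrite /= inordK.
Qed.

(** * The weights *)

Definition delta_exp n (k : int) (a j : 'I_n.+1) : int :=
  if j == a then k else 0.

(** The character of the covering torus on Z_0^q Z_1^{N-q} e_m, for p = (m, q)
    and d = N+1:  (r_a r_b)^d comes from the change of lift,
    (r_a / r_b)^{2q-N} from the spin isomorphism and r_m^{-2d} from da_t. *)
Definition edge_char n N (a b : 'I_n.+1) (p : 'I_n.+1 * 'I_N.+1) (j : 'I_n.+1) :
  int :=
  delta_exp (2 * p.2).+1%:Z a j + delta_exp (2 * (N - p.2)).+1%:Z b j
  - delta_exp (2 * N.+1)%:Z p.1 j.

Lemma prod_delta_exp (C : fieldType) n (r : 'I_n.+1 -> C) k a :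
  \prod_j r j ^ delta_exp k a j = r a ^ k.
Proof.
rewrite (bigD1 a) //= /delta_exp eqxx big1 ?mulr1 // => j /negPf->.
by rewrite expr0z.
Qed.

Lemma prod_edge_char (C : fieldType) n N (a b : 'I_n.+1) p (r : 'I_n.+1 -> C) :
  in_torus r ->
  \prod_j r j ^ @edge_char n N a b p j =
  r a ^+ (2 * p.2).+1 * r b ^+ (2 * (N - p.2)).+1 / r p.1 ^+ (2 * N.+1).
Proof.
move=> r_torus; under eq_bigr => j _ do rewrite !expfzDr //.
rewrite !big_split /= !prod_delta_exp; congr (_ * _ * _).
under eq_bigr => j _ do rewrite -invr_expz.
by rewrite prodfV prod_delta_exp.
Qed.

Lemma edge_act_section_vec (C : fieldType) n N (a b : 'I_n.+1) p k
  (r : 'I_n.+1 -> C) :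
  in_torus r ->
  edge_act N.+1 a b k r (section_vec C p)
  = (k ^ 1 * \prod_j r j ^ @edge_char n N a b p j) *: section_vec C p.
Proof.
move=> r_torus; have ra0 := r_torus a; have rb0 := r_torus b.
have inv_g : invmx (spin_diag a b r) = spin_diag b a r.
  have gK : spin_diag a b r *m spin_diag b a r = 1%:M.
    apply/matrixP => i j; rewrite mul_mx_diag !mxE.
    have [->|_] := eqVneq i j; last by rewrite mulr0n mul0r.
    by case: ifP => _; rewrite !mulr1n; field; rewrite ra0 rb0.
  have [g_unit _] := mulmx1_unit gK.
  by rewrite -[LHS]mulmx1 -gK mulmxA mulVmx // mul1mx.
rewrite prod_edge_char // expr1z /edge_act /susy_act inv_g.
case: p => m q; have le_qN : (q <= N)%N by rewrite -ltnS.
congr (_, _, _); rewrite /= ?mulmx0 ?scaler0 //.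
apply: boolp.funext => Z; apply/rowP => j; rewrite /= !scalrfctE !mxE.
have [->|_] := eqVneq j m; last by rewrite /= !mulr0 mul0r !mulr0.
have ZgE i : \sum_j Z 0 j * spin_diag b a r j i
    = Z 0 i * (if i == 0 then r a / r b else r b / r a).
  transitivity ((Z *m spin_diag b a r) 0 i); first by rewrite mxE.
  by rewrite mul_mx_diag !mxE.
rewrite !ZgE /= /cover_pow; set p := (N - q)%N.
have -> : (r a * r b) ^+ N.+1
    = r a * r b * (r a * r b) ^+ q * (r a * r b) ^+ p.
  by rewrite -mulrA -exprD -exprS subnKC.
have := expf_neq0 (2 * N.+1) (r_torus m); set rm := r m ^+ _ => rm0.
rewrite !exprS ![(2 * _)%N]mulnC !exprM !exprMn !exprVn.
by field; rewrite rm0 !expf_neq0.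
Qed.

Lemma tauD (C : fieldType) n (x y : C) (j : 'I_n.+1) :
  tau (x + y) j = tau x j + tau y j.
Proof. by rewrite /tau scalerDl rmorphD. Qed.

Lemma tauN (C : fieldType) n (x : C) (j : 'I_n.+1) : tau (- x) j = - tau x j.
Proof. by rewrite /tau scaleNr rmorphN. Qed.

Lemma tau0 (C : fieldType) n (j : 'I_n.+1) : tau (0 : C) j = 0.
Proof. by rewrite /tau scale0r rmorph0. Qed.

Lemma sum_tau_delta_exp (C : fieldType) n N k (a : 'I_n.+1) :
  \sum_j tau ((delta_exp k a j)%:~R / N%:R : C) j = tau (k%:~R / N%:R) a.
Proof.
rewrite (bigD1 a) //= /delta_exp eqxx big1 ?addr0 // => j /negPf->.
by rewrite mul0r tau0.
Qed.

Definition edge_weight (C : numFieldType) n d (a b m : 'I_n.+1) (q : nat) :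
  {poly {mpoly C[n.+1]}} :=
  kappa C n
  - tau ((2 * q%:R + 1) / (2 * d%:R)) a
  - tau ((2 * d%:R - 2 * q%:R - 1) / (2 * d%:R)) b
  + tau 1 m.

Lemma weight_edge_char (C : numFieldType) n N (a b : 'I_n.+1) p :
  weight C (2 * N.+1) 1 (@edge_char n N a b p) =
  edge_weight C N.+1 a b p.1 p.2.
Proof.
rewrite /weight /edge_weight mulr1z.
under eq_bigr => j _ do rewrite !rmorphD rmorphN /= !mulrDl mulNr !tauD tauN.
rewrite !big_split /= sumrN !sum_tau_delta_exp.
have le_pN : (p.2 <= N)%N by rewrite -ltnS.
have -> : (2 * p.2).+1%:~R = 2 * p.2%:R + 1 :> C by rewrite -[LHS]natr1 natrM.
have -> : (2 * (N - p.2)).+1%:~R = 2 * N.+1%:R - 2 * p.2%:R - 1 :> C.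
  rewrite -[LHS]natr1 natrM natrB // -[N.+1%:R]natr1; ring.
rewrite -[(2 * N.+1)%:~R]/((2 * N.+1)%:R) divff ?pnatr_eq0 // natrM.
by rewrite !opprD opprK !addrA.
Qed.

(** For m = a the term tau_m combines with the coefficient of tau_a and gives
    the tangent weights of index q; for m = b it combines with that of tau_b
    and gives those of index q + d. *)
Lemma prod_edge_weight (C : numFieldType) n d (a b : 'I_n.+1) :
  (0 < d)%N -> a != b ->
  \prod_(p : 'I_n.+1 * 'I_d) edge_weight C d a b p.1 p.2 =
  (\prod_(0 <= q < 2 * d)
      (kappa C n
       + tau ((2 * d%:R - 2 * q%:R - 1) / (2 * d%:R)) a
       - tau ((2 * d%:R - 2 * q%:R - 1) / (2 * d%:R)) b))
  * \prod_(m < n.+1 | (m != a) && (m != b))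
      \prod_(0 <= q < d) edge_weight C d a b m q.
Proof.
move=> d_gt0 neq_ab; pose w := edge_weight C d a b.
rewrite -(pair_bigA _ (fun m (q : 'I_d) => w m q)) /=.
under eq_bigr => m _ do rewrite -(big_mkord xpredT (w m)).
have d_n0 : d%:R != 0 :> C by rewrite pnatr_eq0 -lt0n.
rewrite (bigD1 a) //= (bigD1 b) 1?eq_sym //= mulrA; congr (_ * _).
rewrite [RHS](@big_cat_nat _ _ _ d) ?leq_pmull //=.
congr (_ * _).
  apply: eq_bigr => q _; rewrite /w /edge_weight -!addrA; congr (_ + _).
  rewrite addrC -addrA [RHS]addrC; congr (_ + _).
  rewrite -tauN -tauD; congr (tau _ a); field.
  by rewrite d_n0.
have shift (f : nat -> {poly {mpoly C[n.+1]}}) :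
    \prod_(d <= q < 2 * d) f q = \prod_(0 <= q < d) f (q + d)%N.
  by rewrite -{1}[d]add0n big_addn mul2n -addnn addnK.
rewrite shift.
apply: eq_bigr => q _; rewrite /w /edge_weight -!addrA; congr (_ + _).
rewrite -!tauN -tauD natrD; congr (tau _ a + tau _ b); field.
  by rewrite d_n0.
by rewrite d_n0.
Qed.

(** * The Euler class *)

Lemma is_euler_class_fin (C : fieldType) (n N : nat) (L : lmodType C)
  (V W : L -> Prop) (rho : C -> ('I_n.+1 -> C) -> L -> L) (I : finType)
  (v : I -> L) (c : I -> int) (E : I -> 'I_n.+1 -> int) :
  (forall i, V (v i)) ->
  (forall x, V x -> exists! y : {ffun I -> C}, W (x - \sum_i y i *: v i)) ->
  (forall i k r, k != 0 -> in_torus r ->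
     W (rho k r (v i) - (k ^ c i * \prod_j r j ^ E i j) *: v i)) ->
  is_euler_class N V W rho (\prod_i weight C N (c i) (E i)).
Proof.
move=> Vv basis eigen.
exists #|I|, (v \o enum_val), (c \o enum_val), (fun i => E (enum_val i)).
have sumE (y : {ffun I -> C}) :
    \sum_(i < #|I|) y (enum_val i) *: v (enum_val i) = \sum_i y i *: v i.
  by rewrite [RHS](reindex _ (onW_bij _ (@enum_val_bij I))).
split=> //=.
- move=> x Vx; have [y [Wy y_unique]] := basis x Vx.
  exists (\row_i y (enum_val i)); split.
    by under eq_bigr => i _ do rewrite mxE; rewrite sumE.
  move=> z Wz; apply/rowP => i; rewrite mxE.
  rewrite (y_unique [ffun i => z 0 (enum_rank i)]) ?ffunE ?enum_valK //.
  by rewrite -sumE; under eq_bigr => j _ do rewrite ffunE enum_valK.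
- by move=> i; apply: eigen.
by rewrite (reindex _ (onW_bij _ (@enum_val_bij I))).
Qed.

Lemma edge_euler_class (C : numFieldType) n d (a b : 'I_n.+1) (A : {set 'I_2}) :
  a != b -> (0 < d)%N -> (0 \in A) != (1 \in A) ->
  is_edge_euler_class d a b A
    ((\prod_(0 <= q < 2 * d)
        (kappa C n
         + tau ((2 * d%:R - 2 * q%:R - 1) / (2 * d%:R)) a
         - tau ((2 * d%:R - 2 * q%:R - 1) / (2 * d%:R)) b))
     * \prod_(m < n.+1 | (m != a) && (m != b))
         \prod_(0 <= q < d) edge_weight C d a b m q).
Proof.
case: d => // N neq_ab d_gt0 sepA; rewrite -(prod_edge_weight C d_gt0 neq_ab).
under eq_bigr => p _ do rewrite -weight_edge_char.
apply: (@is_euler_class_fin _ _ _ _ _ _ _ _ (@section_vec C n N))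
  => [p|x|p k r k0 r_torus].
- exact: section_vec_num.
- exact: section_vec_basis.
rewrite edge_act_section_vec // subrr; exists 0; split=> // Z w _; exists 0.
by rewrite /ev_lin mulmx0 mxE !scale0r addr0 oppr0.
Qed.

Theorem proposition5p3p1 (R : realType) (n d : nat) (a b : 'I_n.+1)
  (A : {set 'I_2}) (hab : (a < b)%N) (hd : (1 <= d)%N)
  (hA : A = [set 0] \/ A = [set 1]) :
  (in_M_Gamma d a b A (edge_map R[i] d a b A) /\
   forall X : map_data R[i] n 2,
     in_M_Gamma d a b A X -> stable_map_iso X (edge_map R[i] d a b A)) /\
  is_edge_euler_class d a b A
    ((\prod_(0 <= q < 2 * d)
        (kappa R[i] n
         + tau ((2 * d%:R - 2 * q%:R - 1) / (2 * d%:R)) a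
         - tau ((2 * d%:R - 2 * q%:R - 1) / (2 * d%:R)) b))
     * \prod_(m < n.+1 | (m != a) && (m != b)) \prod_(0 <= q < d)
        (kappa R[i] n
         - tau ((2 * q%:R + 1) / (2 * d%:R)) a
         - tau ((2 * d%:R - 2 * q%:R - 1) / (2 * d%:R)) b
         + tau 1 m)).
Proof.
have neq_ab : a != b by rewrite neq_ltn hab.
have sepA : (0 \in A) != (1 \in A) by case: hA => ->; rewrite !inE.
split; first split.
- exact: edge_map_in_M_Gamma.
- by move=> X; apply: M_Gamma_point.
exact: edge_euler_class.
Qed.
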